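(* Let $\Omega$ be a compact subset of $\mathbb R^N$ which supports a non-atomic finite measure $m$ satisfying condition (A) and which is absolutely $\alpha$-decaying for some $\alpha>0$. Then $\dim(\Omega\cap\mathrm{Bad}(N))=\dim\Omega$.
   Context: $\dim$ is Hausdorff dimension. $\|y\|$ denotes the distance from $y\in\mathbb R$ to the nearest integer. $\mathrm{Bad}(N)$ is the set of $(x_1,\dots,x_N)\in\mathbb R^N$ for which there is $c>0$ with $\max_{1\le r\le N}\|qx_r\|^{N}>c\,q^{-1}$ for all $q\in\mathbb N$ (for $N=1$ this is the set of badly approximable numbers). Balls are taken with respect to the sup metric on $\mathbb R^N$: $B(x,r)=\{y:\max_i|x_i-y_i|\le r\}$. Condition (A): there are $\delta>0$, $r_0>0$, $0<a\le1\le b$ with $ar^\delta\le m(B(c,r))\le br^\delta$ for all $c\in\Omega$, $r\le r_0$. Absolutely $\alpha$-decaying: there are $C,\alpha,r_0>0$ such that for every affine hyperplane $\mathcal L\subseteq\mathbb R^N$, every $\epsilon>0$, every $x\in\Omega$ and every $r<r_0$, $m(B(x,r)\cap\mathcal L^{(\epsilon)})\le C(\epsilon/r)^\alpha m(B(x,r))$, where $\mathcal L^{(\epsilon)}$ is the $\epsilon$-neighbourhood of $\mathcal L$. *)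

(* Defs.v *)
From HB Require Import structures.
From mathcomp Require Import all_boot all_order all_algebra.
From mathcomp Require Import all_classical all_reals all_analysis.
Set Implicit Arguments. Unset Strict Implicit. Unset Printing Implicit Defensive.
Import Order.TTheory GRing.Theory Num.Theory.
Import numFieldNormedType.Exports.
Local Open Scope classical_set_scope.
Local Open Scope ring_scope.

Section Defs.
Variables (R : realType) (N : nat).
Local Notation V := 'rV[R]_N.

Definition supdist (x y : V) : R := \big[Num.max/0]_(i < N) `|x ord0 i - y ord0 i|.

Definition sball (c : V) (r : R) : set V := [set y | supdist c y <= r].

Definition distnint (y : R) : R :=
  Num.min (y - (Num.floor y)%:~R) ((Num.ceil y)%:~R - y).

Definition Bad : set V :=
  [set x | exists c : R, 0 < c /\ forall q : nat, (0 < q)%N ->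
     (\big[Num.max/0]_(r < N) distnint (q%:R * x ord0 r)) ^+ N > c / q%:R].

Definition borelV := g_sigma_algebraType (@open V).

Definition msupport (m : set borelV -> \bar R) : set V :=
  [set x | forall U : set V, open U -> U x -> (0 < m U)%E].

Definition is_atom (m : set borelV -> \bar R) (A : set borelV) : Prop :=
  measurable A /\ (0 < m A)%E /\
  forall B : set borelV, measurable B -> B `<=` A -> m B = 0%E \/ m B = m A.

Definition non_atomic (m : set borelV -> \bar R) : Prop :=
  forall A, ~ is_atom m A.

Definition condA (Om : set V) (m : set borelV -> \bar R) : Prop :=
  exists delta r0 a b : R, [/\ 0 < delta, 0 < r0, 0 < a, a <= 1 & 1 <= b] /\
    forall c r, Om c -> 0 < r -> r <= r0 ->
      ((a * r `^ delta)%:E <= m (sball c r) <= (b * r `^ delta)%:E)%E.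

Definition affine_hyperplane (L : set V) : Prop :=
  exists (a : V) (t : R), a != 0 /\
    L = [set y | \sum_(i < N) a ord0 i * y ord0 i = t].

Definition nbhd_set (L : set V) (eps : R) : set V :=
  [set y | exists2 z, L z & supdist y z < eps].

Definition abs_decaying (Om : set V) (m : set borelV -> \bar R) (alpha : R) : Prop :=
  exists C r0 : R, 0 < C /\ 0 < r0 /\
    forall (L : set V) (eps : R) (x : V) (r : R),
      affine_hyperplane L -> 0 < eps -> Om x -> 0 < r -> r < r0 ->
      (m (sball x r `&` nbhd_set L eps) <=
        (C * (eps / r) `^ alpha)%:E * m (sball x r))%E.

Definition sdiam (A : set V) : \bar R :=
  ereal_sup [set (supdist x y)%:E | x in A & y in A].

(* contribution diam(U)^s of a covering set (0 for the empty set) *)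
Definition dpow (s : R) (A : set V) : \bar R :=
  match sdiam A with
  | EFin d => (d `^ s)%:E
  | _ => 0%E
  end.

Definition hcontent (s delta : R) (E : set V) : \bar R :=
  ereal_inf [set (\sum_(0 <= i <oo) dpow s (U i))%E |
     U in [set U : nat -> set V |
             E `<=` \bigcup_i U i /\ forall i, (sdiam (U i) <= delta%:E)%E]].

Definition hmeasure (s : R) (E : set V) : \bar R :=
  ereal_sup [set hcontent s delta E | delta in [set d : R | 0 < d]].

Definition hdim (E : set V) : \bar R :=
  ereal_inf [set s%:E | s in [set s : R | 0 <= s /\ hmeasure s E = 0%E]].

End Defs.

(* Main.v *)
Require Import Defs.
From HB Require Import structures.
From mathcomp Require Import all_boot all_order all_algebra perm.
From mathcomp Require Import all_classical all_reals all_analysis.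
From mathcomp Require Import ring lra zify.
Set Implicit Arguments.
Unset Strict Implicit.
Unset Printing Implicit Defensive.
Import Order.TTheory GRing.Theory Num.Theory.
Import numFieldNormedType.Exports.
Local Open Scope classical_set_scope.
Local Open Scope ring_scope.

(* The upper bound dim Om <= delta is a packing count.  For the lower bound, a
   cover (U_i) of Om `&` Bad with small total weight w_i ~ diam(U_i)^s, s < delta,
   is refuted by one point.  Balls B(c_n, r_n), r_n = rho / M^n with M = H^(N+1),
   are nested with centres in Om so that the total weight of the U_i meeting
   B(c_n, r_n) stays below r_(n+1)^s; such U_i have diameter < r_(n+1), hence meet
   at most one of the separated children of the ball.  By the simplex lemma the
   rationals p/q with q <= H^(N(n+1)) near c_n lie on one hyperplane, and by the
   decay condition the ball still has at least M^s children away from it; by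
   pigeonhole one of them inherits the weight bound.  The limit point is badly
   approximable, and the weight of any U_i containing it would be 0.  The weights
   get an extra summand eps / 2^(i+1) so that none of them vanishes. *)

(** * Topology and Borel sets of the sup metric *)

Section SupDistance.
Variables (R : realType) (N : nat).
Local Notation V := 'rV[R]_N.
Implicit Types (x y z c : V) (r : R) (A L : set V).

Lemma supdist_ge0 x y : 0 <= supdist x y.
Proof. exact: bigmax_ge_id. Qed.

Lemma supdist_coord x y i : `|x ord0 i - y ord0 i| <= supdist x y.
Proof. exact: (@le_bigmax _ _ _ 0 (fun i => `|x ord0 i - y ord0 i|)). Qed.

Lemma supdist_le x y r : 0 <= r ->
  (forall i, `|x ord0 i - y ord0 i| <= r) -> supdist x y <= r.
Proof. by move=> r0 h; apply: bigmax_le. Qed.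

Lemma supdist_lt x y r : 0 < r ->
  (forall i, `|x ord0 i - y ord0 i| < r) -> supdist x y < r.
Proof. by move=> r0 h; apply: bigmax_lt. Qed.

Lemma supdistC x y : supdist x y = supdist y x.
Proof. by apply: eq_bigr => i _; rewrite distrC. Qed.

Lemma supdistxx x : supdist x x = 0.
Proof.
apply/eqP; rewrite eq_le supdist_ge0 andbT; apply: supdist_le => // i.
by rewrite subrr normr0.
Qed.

Lemma supdist_triangle y x z : supdist x z <= supdist x y + supdist y z.
Proof.
apply: supdist_le => [|i]; first by rewrite addr_ge0 ?supdist_ge0.
rewrite -[x ord0 i](subrK (y ord0 i)) -addrA; apply: le_trans (ler_normD _ _) _.
by rewrite lerD ?supdist_coord.
Qed.

(** The library's balls on row vectors compare entries, hence are the balls of [supdist]. Openness,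
    closedness and measurability can then be checked with the explicit metric. *)
Lemma nbhs_supdistP x A :
  nbhs x A <-> exists2 e : R, 0 < e & forall y, supdist x y < e -> A y.
Proof.
split=> [/nbhs_ballP[e /= e0 sA]|[e e0 sA]].
  exists e => // y xy; apply: sA; split=> // i j; rewrite (ord1 i).
  exact: le_lt_trans (supdist_coord x y j) xy.
apply/nbhs_ballP; exists e => //= y [_ xy]; apply: sA.
by apply: supdist_lt => // i; exact: xy.
Qed.

Lemma open_supdistP A :
  open A <-> forall x, A x -> exists2 e : R, 0 < e & forall y, supdist x y < e -> A y.
Proof.
rewrite openE; split=> h x Ax; first exact/nbhs_supdistP/h.
by apply/nbhs_supdistP/h.
Qed.

Lemma open_supball c r : open [set y | supdist c y < r].
Proof.
apply/open_supdistP => x /= cx; exists (r - supdist c x); first by rewrite subr_gt0.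
move=> y; rewrite ltrBrDl => xy.
exact: le_lt_trans (supdist_triangle x c y) xy.
Qed.

Lemma closed_sball c r : closed (sball c r).
Proof.
rewrite -openC; apply/open_supdistP => x /negP; rewrite -ltNge => cx.
exists (supdist c x - r); first by rewrite subr_gt0.
move=> y xy; apply/negP; rewrite -ltNge.
have := supdist_triangle y c x; rewrite (supdistC y x); lra.
Qed.

Lemma open_nbhd_set L r : open (nbhd_set L r).
Proof.
apply/open_supdistP => x [z Lz xz].
exists (r - supdist x z); first by rewrite subr_gt0.
move=> y xy; exists z => //.
have := supdist_triangle x y z; rewrite (supdistC y x); lra.
Qed.

Lemma measurable_open_borelV (U : set (@borelV R N)) : open (U : set V) -> measurable U.
Proof. exact: sub_sigma_algebra. Qed.

Lemma measurable_closed_borelV (U : set (@borelV R N)) :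
  closed (U : set V) -> measurable U.
Proof.
move=> cU; rewrite -(setCK U); apply: measurableC.
by apply: measurable_open_borelV; rewrite openC.
Qed.

Lemma measurable_sball c r : measurable (sball c r : set (@borelV R N)).
Proof. by apply: measurable_closed_borelV; exact: closed_sball. Qed.

Lemma measurable_nbhd_set L r : measurable (nbhd_set L r : set (@borelV R N)).
Proof. by apply: measurable_open_borelV; exact: open_nbhd_set. Qed.

Lemma rat_row_dense x r : 0 < r ->
  exists v : 'rV[rat]_N, supdist (map_mx (@ratr R) v) x < r.
Proof.
move=> r0.
have h i : exists q : rat, `|ratr q - x ord0 i| < r.
  have [q] : exists q : rat, ratr q \in `]x ord0 i - r, x ord0 i + r[.
    by apply: rat_in_itvoo; lra.
  by rewrite in_itv /= => /andP[? ?]; exists q; rewrite ltr_norml; apply/andP; split; lra.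
have [f fP] := choice h.
exists (\row_i f i); apply: supdist_lt => // i; rewrite !mxE; exact: fP.
Qed.

End SupDistance.

(** * The complement of the support is null *)

Section Support.
Variables (R : realType) (N : nat).
Local Notation V := 'rV[R]_N.

(** A point outside the support has a null neighbourhood. Inside it lies a null ball with rational
    centre and radius 1/(k+1) that still contains the point, and there are only countably many such
    balls. *)
Lemma negligible_setC_msupport (m : {measure set (@borelV R N) -> \bar R}) :
  m.-negligible (~` msupport m).
Proof.
pose B (v : 'rV[rat]_N) (k : nat) : set (@borelV R N) :=
  [set y | supdist (map_mx (@ratr R) v) y < k.+1%:R^-1].
have mB v k : measurable (B v k) by apply: measurable_open_borelV; exact: open_supball.
(* The index [j] codes a centre and a radius. Balls of positive measure are replaced by the empty
   set, so the union is null. *)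
pose F j := if unpickle j is Some (v, k) then
  (if m (B v k) == 0%E then B v k else set0) else set0.
have nF : m.-negligible (\bigcup_j F j).
  apply: negligible_bigcup => j; rewrite /F.
  case: (unpickle j) => [[v k]|]; last exact: negligible_set0.
  case: eqP => [mB0|_]; last exact: negligible_set0.
  by exists (B v k); split.
apply: negligibleS nF => x /existsNP[U /not_implyP[oU /not_implyP[Ux /negP]]].
rewrite -leNgt => mU0.
have [e e0 sU] := (open_supdistP U).1 oU x Ux.
pose dk k : R := k.+1%:R^-1.
have [k ke] : exists k : nat, k.+1%:R^-1 < e / 2.
  have e20 : 0 < e / 2 by lra.
  have [k _ /(_ k (leqnn k))] := near_infty_natSinv_lt (PosNum e20).
  by exists k.
have [v vx] := @rat_row_dense R N x k.+1%:R^-1 ltac:(by rewrite invr_gt0).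
exists (pickle (v, k)) => //; rewrite /F pickleK.
have -> : m (B v k) = 0%E.
  apply/eqP; rewrite eq_le measure_ge0 andbT; apply: le_trans mU0.
  apply: le_measure; rewrite ?inE //; first exact: measurable_open_borelV.
  move=> y /= vy; apply: sU; apply: le_lt_trans (supdist_triangle (map_mx (@ratr R) v) _ _) _.
  rewrite (supdistC x).
  move: ke vx vy; rewrite -[k.+1%:R^-1]/(dk k) => ke vx vy.
  by apply: lt_trans (ltrD vx (vy : _ < dk k)) _; lra.
by rewrite eqxx.
Qed.

End Support.

(** * Linear algebra and the simplex lemma *)

Section Simplex.

(** Independent rows are picked greedily. Fewer than [n] rows are annihilated by some nonzero [v];
    if no such [v] annihilates all of [S], some [s] in [S] has [s *m v != 0] and is independent of
    the rows chosen so far. *)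
Lemma rows_hyperplane_or_basis (F : fieldType) n (S : set 'rV[F]_n) :
  (exists2 v : 'cV[F]_n, v != 0 & forall s, S s -> s *m v = 0) \/
  (exists2 A : 'M[F]_n, (forall i, S (row i A)) & \det A != 0).
Proof.
case: (pselect (exists2 v : 'cV[F]_n, v != 0 & forall s, S s -> s *m v = 0)) => [|noker].
  by left.
right; suff /(_ n (leqnn n))[A] : forall k, (k <= n)%N ->
    exists2 A : 'M[F]_(k, n), row_free A & forall i, S (row i A).
  by rewrite row_free_unit unitmxE unitfE => detA SA; exists A.
elim=> [_|k IHk kn].
  exists 0; last by case.
  by rewrite /row_free mxrank0.
have [A fA SA] := IHk (ltnW kn).
have [v v0 Av] : exists2 v : 'cV[F]_n, v != 0 & A *m v = 0.
  have : kermx A^T != 0.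
    rewrite kermx_eq0 /row_free mxrank_tr neq_ltn.
    by rewrite (leq_ltn_trans (rank_leq_row A) kn).
  case/rowV0Pn => u /sub_kermxP uA u0; exists u^T.
    by rewrite -(inj_eq (@trmx_inj _ _ _)) trmxK trmx0.
  by apply: trmx_inj; rewrite trmx_mul trmxK uA trmx0.
have [s Ss sv] : exists2 s, S s & s *m v != 0.
  apply: contra_notP noker => h; exists v => // s Ss.
  by apply/eqP; apply: contra_notT h => sv; exists s.
have SsA (i : 'I_(1 + k)) : S (row i (col_mx s A)).
  case: (splitP i) => j ij.
    have -> : i = lshift k j by apply: val_inj.
    by rewrite rowKu row_id.
  have -> : i = rshift 1 j by apply: val_inj.
  by rewrite rowKd.
exists (col_mx s A : 'M[F]_(1 + k, n)) => //.
rewrite -kermx_eq0; apply/rowV0P => u /sub_kermxP; move: u.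
suff free (u : 'rV[F]_(1 + k)) : u *m col_mx s A = 0 -> u = 0 by exact: free.
rewrite -[u]hsubmxK mul_row_col => uA.
(* Multiplying the relation by [v] kills the rows of [A], so the coefficient of [s] must vanish. *)
have : lsubmx u *m (s *m v) = 0.
  by rewrite mulmxA -[LHS]addr0 -[X in _ + X](mulmx0 _ (rsubmx u)) -Av mulmxA -mulmxDl uA mul0mx.
rewrite (mx11_scalar (s *m v)) mul_mx_scalar => /eqP.
rewrite scaler_eq0 => /orP[/eqP sv0|/eqP lu0].
  by move: sv; rewrite (mx11_scalar (s *m v)) sv0 raddf0 eqxx.
move: uA; rewrite lu0 mul0mx add0r => /eqP; rewrite mulmx_free_eq0 // => /eqP ->.
by rewrite row_mx0.
Qed.

(** In the Leibniz expansion each of the n! products takes one entry from every column, so the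
    column bounds give the same estimate for all of them. *)
Lemma det_le_fact_prod (R : numDomainType) n (A : 'M[R]_n) (B : 'I_n -> R) :
  (forall i j, `|A i j| <= B j) -> `|\det A| <= n`!%:R * \prod_j B j.
Proof.
move=> AB; apply: le_trans (ler_norm_sum _ _ _) _.
have -> : n`!%:R * \prod_j B j = \sum_(s : 'S_n) \prod_j B j.
  by rewrite sumr_const card_Sn mulr_natl.
apply: ler_sum => s _; rewrite normrM normrX normrN1 expr1n mul1r normr_prod.
rewrite [leRHS](reindex_inj (@perm_inj _ s)).
by apply: ler_prod => i _; rewrite normr_ge0 AB.
Qed.

(* The simplex lemma: the determinant of N + 1 integer vectors (q, p) spanning
   the space is a nonzero integer, whereas subtracting q *: c from p bounds it
   by (N + 1)! Q ^ (N + 1) r ^ N. *)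
Lemma simplex_hyperplane (R : realType) N (c : 'rV[R]_N) (r Q : R) :
  (0 < N)%N -> 0 <= r -> 0 <= Q -> (N.+1)`!%:R * (Q ^+ N.+1 * r ^+ N) < 1 ->
  exists2 L : set 'rV[R]_N, affine_hyperplane L & forall (q : nat) (p : 'I_N -> int),
    (0 < q)%N -> q%:R <= Q ->
    supdist c (\row_i ((p i)%:~R / q%:R)) <= r -> L (\row_i ((p i)%:~R / q%:R)).
Proof.
move=> N0 r0 Q0 small.
pose good (qp : nat * ('I_N -> int)) := [/\ (0 < qp.1)%N, qp.1%:R <= Q &
    supdist c (\row_i ((qp.2 i)%:~R / qp.1%:R)) <= r].
(* Homogeneous coordinates: rationals on an affine hyperplane correspond to vectors in the kernel of
   one linear form. *)
pose vec (qp : nat * ('I_N -> int)) : 'rV[int]_(1 + N) :=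
  row_mx (qp.1%:Z)%:M (\row_i qp.2 i).
pose S : set 'rV[R]_(1 + N) := [set map_mx intr (vec qp) | qp in good].
have [[v v0 Sv]|[A SA detA]] := rows_hyperplane_or_basis S; last first.
  exfalso.
  have /choice[f fP] : forall i, exists qp, good qp /\ map_mx intr (vec qp) = row i A.
    by move=> i; have [qp gqp eqp] := SA i; exists qp.
  pose Z : 'M[int]_(1 + N) := \matrix_(i, j) vec (f i) 0 j.
  have AZ : A = map_mx intr Z.
    apply/matrixP => i j; rewrite !mxE; have [_ /(congr1 (fun u : 'rV_(1 + N) => u 0 j))] := fP i.
    by rewrite !mxE.
  have detA1 : 1 <= `|\det A|.
    move: detA; rewrite AZ det_map_mx intr_eq0 -intr_norm -[1]/(1%:~R) ler_int.
    by rewrite -normr_gt0 -gtz0_ge1.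
  (* This column operation replaces each row (q, p) by (q, p - qc), whose entries are at most [Q] in
     the first column and [Q * r] in the others. *)
  pose U : 'M[R]_(1 + N) := block_mx 1%:M (- c) 0 1%:M.
  have detU : \det U = 1 by rewrite /U det_ublock !det1 mulr1.
  pose B (j : 'I_(1 + N)) := if fintype.split j is inl _ then Q else Q * r.
  have AU i j : `|(A *m U) i j| <= B j.
    have [[q0 qQ cr] fiA] := fP i.
    have -> : (A *m U) i j = (row i A *m U) 0 j by rewrite -row_mul [RHS]mxE.
    rewrite -fiA /vec map_row_mx mul_row_block mulmx0 addr0 !mulmx1.
    rewrite map_scalar_mx -[X in row_mx X]scale1r.
    rewrite /B; case: (splitP j) => k jk.
      have -> : j = lshift N k by apply: val_inj.
      by rewrite row_mxEl ord1 !mxE eqxx mulr1n mul1r /= -pmulrn normr_nat.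
    have -> : j = rshift 1 k by apply: val_inj.
    rewrite row_mxEr mul_scalar_mx !mxE /= -pmulrn.
    have q0R : 0 < (f i).1%:R :> R by rewrite ltr0n.
    have := le_trans (supdist_coord _ _ k) cr; rewrite mxE => ck.
    rewrite (_ : _ + _ = - ((f i).1%:R * (c ord0 k - ((f i).2 k)%:~R / (f i).1%:R))); last first.
      by field; rewrite gt_eqF.
    by rewrite normrN normrM normr_nat ler_pM.
  have := det_le_fact_prod AU; rewrite det_mulmx detU mulr1.
  rewrite big_split_ord /= big_ord1 /B.
  have -> : \prod_(i < N) (if fintype.split (rshift 1 i) is inl _ then Q else Q * r) = (Q * r) ^+ N.
    rewrite (eq_bigr (fun=> Q * r)) ?prodr_const ?card_ord // => i _.
    by case: splitP => // k /= ik; have := ltn_ord k; rewrite -ik.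
  case: splitP => [k _|k /= ]; last by [].
  rewrite exprMn [Q * _]mulrA -exprS => le_det.
  by have := lt_le_trans small detA1; rewrite ltNge le_det.
pose a : 'rV[R]_N := (dsubmx v)^T.
(* If the normal vector vanishes, the form is a nonzero multiple of q and annihilates no vector with
   q > 0. Then there are no rationals to contain and any hyperplane serves. *)
have [a0|a0] := eqVneq a 0.
  exists [set y | \sum_(i < N) (const_mx 1 : 'rV[R]_N) ord0 i * y ord0 i = 0].
    exists (const_mx 1), 0; split => //; apply/eqP => /rowP/(_ (Ordinal N0)).
    by rewrite !mxE => /eqP; rewrite oner_eq0.
  move=> q p q0 qQ cr; exfalso; move/negP: v0; apply.
  have := Sv _ (ex_intro2 _ _ (q, p) (And3 q0 qQ cr) erefl).
  have d0 : dsubmx v = 0 by rewrite -[LHS]trmxK -/a a0 trmx0.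
  rewrite -{1 2}[v]vsubmxK d0 /vec map_row_mx mul_row_col mulmx0 addr0 map_scalar_mx.
  rewrite mul_scalar_mx => /eqP; rewrite scaler_eq0 /= -pmulrn pnatr_eq0.
  by rewrite gtn_eqF //= => /eqP ->; rewrite col_mx0.
exists [set y | \sum_(i < N) a ord0 i * y ord0 i = - usubmx v 0 0].
  by exists a, (- usubmx v 0 0).
move=> q p q0 qQ cr /=.
have q0R : q%:R != 0 :> R by rewrite pnatr_eq0 -lt0n.
have := Sv _ (ex_intro2 _ _ (q, p) (And3 q0 qQ cr) erefl).
rewrite -{1}[v]vsubmxK /vec map_row_mx mul_row_col map_scalar_mx mul_scalar_mx.
move/(congr1 (fun M : 'M[R]_1 => M 0 0)); rewrite !mxE /= -pmulrn => /eqP.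
rewrite addrC addr_eq0 => /eqP E.
apply: (mulfI q0R); rewrite mulrN -E mulr_sumr; apply: eq_bigr => i _.
by rewrite !mxE; field.
Qed.

End Simplex.

(** * Hausdorff content, measure and dimension *)

Section HausdorffDimension.
Variables (R : realType) (N : nat).
Local Notation V := 'rV[R]_N.
Implicit Types (x y z c : V) (r s d : R) (A E : set V) (U : nat -> set V).

Lemma supdist_le_sdiam A x y : A x -> A y -> ((supdist x y)%:E <= sdiam A)%E.
Proof. by move=> Ax Ay; apply: ereal_sup_ubound; exists x => //; exists y. Qed.

Lemma sdiam_sball c r : 0 <= r -> (sdiam (sball c r) <= (2 * r)%:E)%E.
Proof.
move=> r0; apply: ge_ereal_sup => _ [x cx [y cy] <-]; rewrite lee_fin.
apply: le_trans (supdist_triangle c x y) _; rewrite (supdistC x) mulr2n mulrDl mul1r.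
exact: lerD.
Qed.

Lemma sdiam_set0 : sdiam (set0 : set V) = -oo%E.
Proof.
rewrite /sdiam (_ : image2 _ _ _ = set0) ?ereal_sup0 //.
by apply/seteqP; split => // e [x []].
Qed.

Lemma dpow_ge0 s A : (0 <= dpow s A)%E.
Proof. by rewrite /dpow; case: (sdiam A) => // d; rewrite lee_fin powR_ge0. Qed.

Lemma dpow_set0 s : dpow s (set0 : set V) = 0%E.
Proof. by rewrite /dpow sdiam_set0. Qed.

Lemma sdiam_ge0 A x : A x -> (0 <= sdiam A)%E.
Proof. by move=> Ax; rewrite -[0%E]/((0:R)%:E) -(supdistxx x) supdist_le_sdiam. Qed.

Lemma dpow_le s d A : 0 <= s -> (sdiam A <= d%:E)%E -> (dpow s A <= (d `^ s)%:E)%E.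
Proof.
move=> s0; have [->|/set0P[x /sdiam_ge0]] := eqVneq A set0.
  by rewrite dpow_set0 lee_fin powR_ge0.
rewrite /dpow; case: (sdiam A) => [e|//|//]; rewrite !lee_fin => e0 ed.
by rewrite ge0_ler_powR // nnegrE // (le_trans e0 ed).
Qed.

(* Once diameters are at most 1, weights for the exponent s dominate those for
   any larger exponent t. *)
Lemma powR_supdist_le_dpow s t A x y : 0 <= s -> s <= t -> (sdiam A <= 1%:E)%E ->
  A x -> A y -> (((supdist x y) `^ t)%:E <= dpow s A)%E.
Proof.
move=> s0 st A1 Ax Ay; move: (supdist_le_sdiam Ax Ay) A1; rewrite /dpow.
case: (sdiam A) => [d|//|//]; rewrite !lee_fin => xyd d1.
have xy0 := supdist_ge0 x y.
apply: (@le_trans _ _ (supdist x y `^ s)); last first.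
  by rewrite ge0_ler_powR // nnegrE // (le_trans xy0 xyd).
(* Distance 0 is treated apart because 0 to the power 0 is 1; in that case [t = 0] forces
   [s = 0]. *)
have [xy00|xy_neq0] := eqVneq (supdist x y) 0.
  rewrite xy00; have [t0|t0] := eqVneq t 0; last by rewrite powR0 // powR_ge0.
  by rewrite (_ : s = t) //; apply/eqP; rewrite eq_le st t0.
by rewrite ger_powR // lt_def xy_neq0 xy0 (le_trans xyd d1).
Qed.

Lemma hcontent_ge0 s d E : (0 <= hcontent s d E)%E.
Proof.
by apply: le_ereal_inf_tmp => _ [U _ <-]; apply: nneseries_ge0 => i _ _; exact: dpow_ge0.
Qed.

Lemma hmeasure_ge0 s E : (0 <= hmeasure s E)%E.
Proof.
by apply: (@le_trans _ _ (hcontent s 1 E)); [exact: hcontent_ge0|apply: ereal_sup_ubound; exists 1 => //=; exact: ltr01].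
Qed.

Lemma hcontent_subset s d A E : A `<=` E -> (hcontent s d A <= hcontent s d E)%E.
Proof.
move=> AE; apply: ereal_inf_le_tmp => _ [U [EU Ud] <-]; exists U => //; split => //.
exact: subset_trans AE EU.
Qed.

Lemma hmeasure_subset s A E : A `<=` E -> (hmeasure s A <= hmeasure s E)%E.
Proof.
move=> AE; apply: ge_ereal_sup => _ [d d0 <-]; apply: le_trans (hcontent_subset _ _ AE) _.
by apply: ereal_sup_ubound; exists d.
Qed.

Lemma hdim_subset A E : A `<=` E -> (hdim A <= hdim E)%E.
Proof.
move=> AE; apply: ereal_inf_le_tmp => _ [s [s0 Es] <-]; exists s => //; split => //.
by apply/eqP; rewrite eq_le hmeasure_ge0 andbT -Es hmeasure_subset.
Qed.

(** The finite list of balls is padded to a sequence by empty sets, which have weight 0; each ball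
    has diameter at most [2 * r]. *)
Lemma hcontent_le_size s d r E (l : seq V) : 0 <= s -> 0 <= r -> 2 * r <= d ->
  (forall x, E x -> exists2 c, c \in l & supdist c x <= r) ->
  (hcontent s d E <= ((size l)%:R * (2 * r) `^ s)%:E)%E.
Proof.
move=> s0 r0 rd El.
pose U i := if (i < size l)%N then sball (nth 0 l i) r else set0.
apply: (@le_trans _ _ (\sum_(0 <= i <oo) dpow s (U i))%E).
  apply: ereal_inf_lbound; exists U => //; split.
    move=> x /El[c cl cx]; exists (index c l) => //.
    by rewrite /U index_mem cl nth_index.
  move=> i; rewrite /U; case: ifP => _; last by rewrite sdiam_set0 leNye.
  by apply: le_trans (sdiam_sball _ r0) _; rewrite lee_fin.
apply: lime_le; first by apply: is_cvg_nneseries => i _ _; exact: dpow_ge0.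
apply: nearW => n.
have b0 := powR_ge0 (2 * r) s.
apply: (@le_trans _ _ ((minn n (size l))%:R * (2 * r) `^ s)%:E); last first.
  by rewrite lee_fin ler_wpM2r // ler_nat geq_minr.
elim: n => [|n IHn]; first by rewrite big_nil lee_fin mulr_ge0.
rewrite big_nat_recr //= /U; case: ltnP => nl.
  rewrite (minn_idPl nl) -natr1 mulrDl mul1r EFinD.
  apply: leeD; first by rewrite (minn_idPl (ltnW nl)) in IHn.
  by apply: dpow_le => //; exact: sdiam_sball.
rewrite dpow_set0 adde0 (minn_idPr (leqW nl)).
by rewrite (minn_idPr nl) in IHn.
Qed.

(** For the exponent [delta + e] the coverings by balls of radius r cost at most a constant times
    the e-th power of r, which tends to 0 with r. *)
Lemma hdim_le_covering (E : set V) (delta r1 K : R) : 0 < delta -> 0 < r1 ->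
  (forall r, 0 < r -> r <= r1 -> exists2 l : seq V,
     (forall x, E x -> exists2 c, c \in l & supdist c x <= r) &
     (size l)%:R * r `^ delta <= K) ->
  (hdim E <= delta%:E)%E.
Proof.
move=> delta0 r10 cov; apply/lee_addgt0Pr => e e0; rewrite -EFinD.
apply: ereal_inf_lbound; exists (delta + e) => //; split; first lra.
apply/eqP; rewrite eq_le hmeasure_ge0 andbT.
apply: ge_ereal_sup => _ [d /= d0 <-].
apply/lee_addgt0Pr => eta eta0; rewrite add0e.
have K0 : 0 <= K.
  have [l _ lK] := cov r1 r10 (lexx _); apply: le_trans lK.
  by rewrite mulr_ge0 // powR_ge0.
pose C := (K + 1) * 2 `^ (delta + e).
have C0 : 0 < C by rewrite mulr_gt0 ?powR_gt0 //; lra.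
(* The first entry brings the cost below [eta], [r1] makes the covering hypothesis available, and
   [d / 2] keeps diameters at most [d]. *)
pose r := Num.min ((eta / C) `^ e^-1) (Num.min r1 (d / 2)).
have r0 : 0 < r by rewrite !lt_min powR_gt0 ?divr_gt0 // r10.
have [l El lK] : exists2 l : seq V,
     (forall x, E x -> exists2 c, c \in l & supdist c x <= r) &
     (size l)%:R * r `^ delta <= K by apply: cov; rewrite // !ge_min lexx orbT.
apply: le_trans (hcontent_le_size _ (ltW r0) _ El) _; first lra.
  by rewrite mulrC -ler_pdivlMr // !ge_min lexx !orbT.
rewrite lee_fin powRM ?(ltW r0) // (@powRD _ r); last by rewrite (gt_eqF r0) implybT.
have re : r `^ e <= eta / C.
  have eC0 : 0 <= eta / C by rewrite divr_ge0 ?ltW.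
  have <- : ((eta / C) `^ e^-1) `^ e = eta / C.
    by rewrite -powRrM mulVf ?powRr1 // gt_eqF.
  apply: ge0_ler_powR; rewrite ?nnegrE ?powR_ge0 ?(ltW e0) ?(ltW r0) //.
  by rewrite /r ge_min lexx.
rewrite (_ : _ * _ = (size l)%:R * r `^ delta * 2 `^ (delta + e) * r `^ e); last by ring.
apply: (@le_trans _ _ (C * (eta / C))); last by rewrite mulrC divfK // gt_eqF.
apply: ler_pM => //; rewrite ?mulr_ge0 ?powR_ge0 //.
by rewrite ler_wpM2r ?powR_ge0 //; lra.
Qed.

End HausdorffDimension.

(** * Packings and coverings counted by measure *)

Section RegularMeasure.
Variables (R : realType) (N : nat) (m : {measure set (@borelV R N) -> \bar R}).
Local Notation V := 'rV[R]_N.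
Variable Om : set V.
Implicit Types (x y z c : V) (r s d : R) (l : seq V).

Let balls r l : set (@borelV R N) := \big[setU/set0]_(c <- l) (sball c r : set (@borelV R N)).

Lemma in_balls r l x : balls r l x <-> exists2 c, c \in l & supdist c x <= r.
Proof.
rewrite /balls; elim: l => [|c l IHl]; first by rewrite big_nil; split => // -[].
rewrite big_cons; split=> [[cx|/IHl[c' c'l c'x]]|[c']].
- by exists c => //; rewrite mem_head.
- by exists c' => //; rewrite in_cons c'l orbT.
- rewrite in_cons => /orP[/eqP ->|c'l c'x]; first by left.
  by right; apply/IHl; exists c'.
Qed.

Lemma measurable_balls r l : measurable (balls r l).
Proof. by apply: bigsetU_measurable => c _; exact: measurable_sball. Qed.

Lemma measure_balls_le r l (v : R) : (forall c, c \in l -> (m (sball c r) <= v%:E)%E) ->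
  (m (balls r l) <= ((size l)%:R * v)%:E)%E.
Proof.
rewrite /balls; elim: l => [|c l IHl] lv; first by rewrite big_nil measure0 mul0r.
rewrite big_cons /= -natr1 mulrDl mul1r addrC EFinD.
apply: le_trans (measureU2 _ (measurable_sball _ _) (measurable_balls _ _)) _.
apply: leeD; first by apply: lv; rewrite mem_head.
by apply: IHl => c' c'l; apply: lv; rewrite in_cons c'l orbT.
Qed.

Lemma measure_balls_ge r l (v : R) : (forall c, c \in l -> (v%:E <= m (sball c r))%E) ->
  pairwise (fun x y => 2 * r < supdist x y) l ->
  (((size l)%:R * v)%:E <= m (balls r l))%E.
Proof.
rewrite /balls; elim: l => [|c l IHl] lv /=; first by rewrite big_nil measure0 mul0r.
move=> /andP[/allP cl pl].
rewrite big_cons measureU; last 1 first.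
- apply/seteqP; split => // x [cx /in_balls[c' /cl c'l c'x]].
  have := supdist_triangle x c c'; rewrite (supdistC x c').
  move: (cx : supdist c x <= r); lra.
- rewrite -natr1 mulrDl mul1r addrC EFinD.
  apply: leeD; first by apply: lv; rewrite mem_head.
  by apply: IHl => // c' c'l; apply: lv; rewrite in_cons c'l orbT.
- exact: measurable_sball.
- exact: measurable_balls.
Qed.

(** Greedy selection: at most [k] balls of measure at most [v], together with the null complement of
    [Om], cannot cover [G], so a point of [G] and [Om] farther than [r] from all chosen centres
    remains. *)
Lemma separated_centers (G : set (@borelV R N)) r (v : R) k :
  m.-negligible (~` Om) -> measurable (Om : set (@borelV R N)) ->
  measurable G -> 0 <= v ->
  (forall c, Om c -> (m (sball c r) <= v%:E)%E) -> ((k%:R * v)%:E < m G)%E ->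
  exists l, [/\ size l = k.+1, forall c, c \in l -> Om c /\ G c &
    pairwise (fun x y => r < supdist x y) l].
Proof.
move=> nOm mOm mG v0 ballv kG.
suff : forall j, (j <= k.+1)%N -> exists l, [/\ size l = j, forall c, c \in l -> Om c /\ G c &
    pairwise (fun x y => r < supdist x y) l] by apply.
elim=> [_|j IHj jk]; first by exists [::].
have [l [lj lG pl]] := IHj (ltnW jk).
have [x [Gx Omx xl]] : exists x, [/\ G x, Om x & ~ balls r l x].
  apply/not_existsP => h; move: kG; apply/negP; rewrite -leNgt.
  have GU : G `<=` balls r l `|` ~` Om.
    move=> x Gx; case: (pselect (Om x)) => Omx; last by right.
    left; apply: contrapT => xl; exact: (h x).
  have mOmC : measurable (~` Om : set (@borelV R N)) by exact: measurableC.
  apply: (@le_trans _ _ (m (balls r l `|` ~` Om))).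
    apply: le_measure => //; rewrite inE //.
    by apply: measurableU => //; exact: measurable_balls.
  apply: le_trans (measureU2 _ (measurable_balls _ _) mOmC) _.
  have /= -> := measure_negligible mOmC nOm; rewrite adde0.
  apply: le_trans (measure_balls_le (v := v) _) _.
    by move=> c /lG[Omc _]; exact: ballv.
  by rewrite lee_fin ler_wpM2r // lj ler_nat -ltnS.
exists (x :: l); split => [|c|]; first by rewrite /= lj.
  by rewrite in_cons => /orP[/eqP -> //|/lG].
rewrite /= pl andbT; apply/allP => c cl; rewrite ltNge; apply/negP => xc.
by apply: xl; apply/in_balls; exists c => //; rewrite supdistC.
Qed.

(* A maximal 2r-separated subset of Om. *)
Lemma separated_covering r (v M : R) : 0 <= r -> 0 < v -> (m setT <= M%:E)%E ->
  (forall c, Om c -> (v%:E <= m (sball c r))%E) ->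
  exists2 l, (forall x, Om x -> exists2 c, c \in l & supdist c x <= 2 * r) &
    (size l)%:R * v <= M.
Proof.
move=> r0 v0 mM ballv.
pose sep l := (forall c, c \in l -> Om c) /\ pairwise (fun x y => 2 * r < supdist x y) l.
have sepM l : sep l -> (size l)%:R * v <= M.
  move=> [lOm pl]; rewrite -lee_fin; apply: le_trans mM.
  apply: le_trans (measure_balls_ge (v := v) _ pl) _ => [c /lOm|]; first exact: ballv.
  by apply: le_measure; rewrite ?inE //; exact: measurable_balls.
(* The cardinalities of separated lists are bounded by [M / v], so a largest one exists; a point
   left uncovered could be added to it. *)
pose P n := `[< exists2 l, sep l & size l = n >].
have P0 : exists n, P n by exists 0%N; apply/asboolP; exists [::].
have bP n : P n -> (n <= Num.trunc (M / v))%N.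
  move=> /asboolP[l /sepM lM <-]; rewrite Num.Theory.truncn_ge_nat; last first.
    by rewrite ler_pdivlMr // (le_trans _ lM) // mul0r mulr_ge0 // ltW.
  by rewrite ler_pdivlMr.
case: (ex_maxnP P0 bP) => n /asboolP[l [lOm pl] ln] nmax.
exists l; last exact: sepM.
move=> x Omx; apply: contrapT => xl; suff : P n.+1 by move=> /nmax; rewrite ltnn.
apply/asboolP; exists (x :: l); last by rewrite /= ln.
split=> [c|]; first by rewrite in_cons => /orP[/eqP ->|/lOm].
rewrite /= pl andbT; apply/allP => c cl; rewrite ltNge; apply/negP => xc.
by apply: xl; exists c => //; rewrite supdistC.
Qed.

End RegularMeasure.

(** Matches the two scales: with h = H and k = N, the (N+1)-th power of the denominator bound H^(Nn)
    is the N-th power of M^n, where M = H^(N+1). *)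
Lemma expnMSAC h k n : ((h ^ (k * n)) ^ k.+1 = ((h ^ k.+1) ^ n) ^ k)%N.
Proof. by rewrite -!expnM; congr expn; lia. Qed.

(** * Nested balls and bad approximability of their limit point *)

Section CantorScheme.
Variables (R : realType) (N : nat).
Local Notation V := 'rV[R]_N.
Implicit Types (x y z c : V) (r s t d : R) (l : seq V).

Lemma powR_ge_eventually (p B : R) : 0 < p -> exists X : R, forall y : R, X <= y -> B <= y `^ p.
Proof.
move=> p0; exists ((Num.max B 0) `^ p^-1) => y Xy.
apply: (@le_trans _ _ (Num.max B 0)); first by rewrite le_max lexx.
have B0 : 0 <= Num.max B 0 by rewrite le_max lexx orbT.
have <- : ((Num.max B 0) `^ p^-1) `^ p = Num.max B 0.
  by rewrite -powRrM mulVf ?powRr1 // gt_eqF.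
apply: ge0_ler_powR; rewrite ?nnegrE ?powR_ge0 ?(ltW p0) //.
by apply: le_trans Xy; rewrite powR_ge0.
Qed.

Lemma geometric_radius_small (M rho e : R) : 2 <= M -> 0 < rho -> 0 < e ->
  exists n, rho / M ^+ n < e.
Proof.
move=> M2 rho0 e0; exists (Num.bound (rho / e)).
set n := Num.bound _.
have Mn0 : 0 < M ^+ n by rewrite exprn_gt0 //; lra.
rewrite ltr_pdivrMr // mulrC -ltr_pdivrMr //.
apply: (@lt_le_trans _ _ n%:R); first by apply: archi_boundP; rewrite divr_ge0 // ltW.
apply: (@le_trans _ _ (2 ^+ n)); first by rewrite -natrX ler_nat ltnW // ltn_expl.
by rewrite lerXn2r // ?nnegrE //; lra.
Qed.

Lemma distnint_lt (y e : R) : distnint y < e -> exists p : int, `|y - p%:~R| < e.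
Proof.
rewrite /distnint gt_min => /orP[ye|ye].
  by exists (Num.floor y); rewrite ger0_norm // subr_ge0 floor_le.
exists (Num.ceil y); rewrite ler0_norm ?opprB // subr_le0.
by have /andP[] := ceil_itv y.
Qed.

(** In each coordinate every lower endpoint lies below every upper endpoint, so the supremum of the
    lower endpoints belongs to all the intervals. *)
Lemma nested_balls (c : nat -> V) (r : nat -> R) :
  (forall n, supdist (c n) (c n.+1) + r n.+1 <= r n) -> (forall n, 0 <= r n) ->
  exists x, forall n, supdist (c n) x <= r n.
Proof.
move=> step r0.
have nest n k : supdist (c n) (c (n + k)%N) + r (n + k)%N <= r n.
  elim: k => [|k IHk]; first by rewrite addn0 supdistxx add0r.
  have := step (n + k)%N; rewrite addnS.
  have := supdist_triangle (c (n + k)%N) (c n) (c (n + k).+1); lra.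
have cross i n k : c n ord0 i - r n <= c k ord0 i + r k.
  wlog: / (n <= k)%N => [wl|nk].
  - case: (leqP n k) => [/wl //|/ltnW kn].
    have := nest k (n - k)%N; rewrite subnKC // => h.
    have := supdist_coord (c k) (c n) i; rewrite ler_norml => /andP[? ?].
    have := r0 n; have := r0 k; lra.
  - have := nest n (k - n)%N; rewrite subnKC // => h.
    have := supdist_coord (c n) (c k) i; rewrite ler_norml => /andP[? ?].
    have := r0 n; have := r0 k; lra.
pose S i := range (fun n => c n ord0 i - r n).
have supS i : has_sup (S i).
  split; first by exists (c 0%N ord0 i - r 0%N), 0%N.
  by exists (c 0%N ord0 i + r 0%N) => _ [n _ <-].
exists (\row_i sup (S i)) => n; apply: supdist_le => // i; rewrite mxE ler_norml.
have h1 : c n ord0 i - r n <= sup (S i).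
  by apply: sup_ubound; [exact: (supS i).2|exists n].
have h2 : sup (S i) <= c n ord0 i + r n.
  by apply: sup_le_ub; [exact: (supS i).1|move=> _ [k _ <-]].
by apply/andP; split; lra.
Qed.

Lemma closed_limit_balls (A : set V) (c : nat -> V) (r : nat -> R) x :
  closed A -> (forall n, A (c n)) -> (forall n, supdist (c n) x <= r n) ->
  (forall e : R, 0 < e -> exists n, r n < e) -> A x.
Proof.
move=> cA Ac cx rsmall; apply: cA => B /nbhs_supdistP[e e0 sB].
have [n rn] := rsmall e e0.
by exists (c n); split=> //; apply: sB; rewrite supdistC (le_lt_trans (cx n)).
Qed.

(** Let H^(Nn) <= q < H^(N(n+1)) and let r be the radius of level n+1. A rational p/q closer than r
    to [x] would lie on [L n] and within 2r of [c n.+1], which is excluded. So some coordinate of qx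
    is at least qr away from the integers, and q times the N-th power of qr is at least the N-th
    power of [rho / M]. *)
Lemma Bad_avoiding_hyperplanes (H : nat) (rho : R) (c : nat -> V) (L : nat -> set V) x :
  (0 < N)%N -> (1 < H)%N -> 0 < rho ->
  let M : R := (H ^ N.+1)%:R in
  (forall n, supdist (c n) x <= rho / M ^+ n) ->
  (forall n (q : nat) (p : 'I_N -> int), (0 < q)%N -> q%:R <= (H ^ (N * n.+1))%:R :> R ->
    supdist (c n) (\row_i ((p i)%:~R / q%:R)) <= 2 * (rho / M ^+ n) ->
    L n (\row_i ((p i)%:~R / q%:R))) ->
  (forall n, ~ nbhd_set (L n) (2 * (rho / M ^+ n.+1)) (c n.+1)) ->
  Bad x.
Proof.
move=> N0 H1 rho0 M cx Lrat avoid.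
have HN1 : (1 < H ^ N)%N by rewrite -(exp1n N) ltn_exp2r.
have M1 : 1 <= M by rewrite ler1n expn_gt0 (ltnW H1).
have M0 : 0 < M by lra.
(* The factor 1/2 provides the strict inequality in [Bad]. *)
exists ((rho / M) ^+ N / 2); split; first by rewrite divr_gt0 // exprn_gt0 // divr_gt0.
move=> q q0; set mx := \big[_/_]_(_ < _) _.
(* The logarithm of q to the base H^N selects the level. *)
have [qlo qhi] := andP (trunc_log_bounds HN1 q0).
set n := trunc_log _ _ in qlo qhi.
have q0R : 0 < q%:R :> R by rewrite ltr0n.
pose r := rho / M ^+ n.+1.
have r0 : 0 < r by rewrite divr_gt0 // exprn_gt0.
have rn : r <= rho / M ^+ n.
  rewrite /r ler_pM2l // lef_pV2 ?posrE ?exprn_gt0 // exprS.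
  by rewrite ler_peMl // exprn_ge0 // ltW.
have mxr : q%:R * r <= mx.
  rewrite leNgt; apply/negP => mxlt.
  have /choice[p px] : forall i, exists p : int, `|q%:R * x ord0 i - p%:~R| < q%:R * r.
    move=> i; apply: distnint_lt; apply: le_lt_trans mxlt.
    exact: (@le_bigmax _ _ _ 0 (fun i => distnint (q%:R * x ord0 i))).
  pose z : V := \row_i ((p i)%:~R / q%:R).
  have xz : supdist x z < r.
    apply: supdist_lt => // i; rewrite mxE -(ltr_pM2l q0R).
    rewrite -[X in X * `|_|](ger0_norm (ltW q0R)) -normrM mulrBr.
    by rewrite [q%:R * (_ / _)]mulrC divfK ?gt_eqF.
  apply: (avoid n); exists z.
    apply: Lrat => //; first by rewrite ler_nat expnM ltnW.
    have := supdist_triangle x (c n) z; have := cx n; rewrite -/z; lra.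
  have := supdist_triangle x (c n.+1) z; have := cx n.+1; rewrite -/r; lra.
have qr0 : 0 < q%:R * r by rewrite mulr_gt0.
apply: (@lt_le_trans _ _ ((q%:R * r) ^+ N)); last first.
  by rewrite lerXn2r // nnegrE ltW // (lt_le_trans qr0).
rewrite ltr_pdivrMr //; apply: (@lt_le_trans _ _ ((rho / M) ^+ N)).
  have : 0 < (rho / M) ^+ N by rewrite exprn_gt0 // divr_gt0.
  lra.
have Mq : M ^+ n ^+ N <= q%:R ^+ N.+1.
  rewrite /M -!natrX ler_nat.
  by rewrite -expnMSAC leq_exp2r // expnM.
rewrite [(q%:R * r) ^+ N]exprMn mulrAC -exprSr.
apply: (@le_trans _ _ (M ^+ n ^+ N * r ^+ N)); last first.
  by rewrite ler_wpM2r // exprn_ge0 // ltW.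
rewrite -exprMn /r exprS.
rewrite (_ : M ^+ n * _ = rho / M) //.
by field; rewrite expf_neq0 ?gt_eqF.
Qed.

End CantorScheme.

(** * Weight of the cover sets that meet a ball *)

Section CoverWeight.
Variables (R : realType) (N : nat).
Local Notation V := 'rV[R]_N.
Implicit Types (x y z c : V) (r : R) (l : seq V).
Variables (w : nat -> \bar R) (U : nat -> set V).
Hypothesis w_ge0 : forall i, (0 <= w i)%E.

Definition meets (A : set V) c r := exists2 x, A x & supdist c x <= r.

Definition ball_weight c r : \bar R :=
  (\sum_(0 <= i <oo) (if `[< meets (U i) c r >] then w i else 0%E))%E.

Lemma meets_weight_ge0 c r i :
  (0 <= if `[< meets (U i) c r >] then w i else 0%E)%E.
Proof. by case: ifP. Qed.

Lemma le_ball_weight c r i : meets (U i) c r -> (w i <= ball_weight c r)%E.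
Proof.
move=> Ui; apply: le_trans (nneseries_lim_ge (m := 0) i.+1 _) => [|j _ _]; last first.
  exact: meets_weight_ge0.
rewrite big_nat_recr //= asboolT // leeDr //.
by apply: sume_ge0 => j _; exact: meets_weight_ge0.
Qed.

Lemma ball_weight_le c r : (ball_weight c r <= \sum_(0 <= i <oo) w i)%E.
Proof.
by apply: lee_nneseries => [i _ _|i _]; [exact: meets_weight_ge0|case: ifP].
Qed.

(* Sets meeting the big ball are too small to meet two of the separated
   children, so the weights of the children add up to at most that of the ball. *)
Lemma exists_light_child c r r' (tau tau' : R) l :
  (forall c', c' \in l -> supdist c c' + r' <= r) ->
  pairwise (fun x y => 3 * r' < supdist x y) l ->
  (forall i x y, meets (U i) c r -> U i x -> U i y -> supdist x y < r') ->
  (ball_weight c r < tau%:E)%E -> tau <= (size l)%:R * tau' ->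
  exists2 c', c' \in l & (ball_weight c' r' < tau'%:E)%E.
Proof.
move=> lc pl small Wc tau_le; apply: contrapT => h.
have heavy c' : c' \in l -> (tau'%:E <= ball_weight c' r')%E.
  by move=> c'l; rewrite leNgt; apply/negP => lt; apply: h; exists c'.
suff : (\sum_(c' <- l) ball_weight c' r' <= ball_weight c r)%E.
  apply/negP; rewrite -ltNge; apply: lt_le_trans Wc _.
  apply: (@le_trans _ _ (\sum_(c' <- l) tau'%:E)%E).
    by rewrite sumEFin lee_fin big_const_seq count_predT iter_addr_0 -mulr_natl.
  by rewrite big_seq [leRHS]big_seq; apply: lee_sum.
(* After exchanging the sums it suffices to compare the contributions of each single [U i]. *)
rewrite -nneseries_sum; last by move=> c' i _; exact: meets_weight_ge0.
apply: lee_nneseries => [i _ _|i _]; first by apply: sume_ge0 => c' _; exact: meets_weight_ge0.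
have meets_child c' : c' \in l -> meets (U i) c' r' -> meets (U i) c r.
  move=> c'l [x Ux c'x]; exists x => //.
  apply: le_trans (supdist_triangle c' c x) _; apply: le_trans (lc c' c'l).
  by rewrite lerD2l.
elim: (l) meets_child pl => [|c' k IHk] mk /=.
  by rewrite big_nil => _; exact: meets_weight_ge0.
move=> /andP[/allP c'k pk]; rewrite big_cons.
have mk' c'' : c'' \in k -> meets (U i) c'' r' -> meets (U i) c r.
  by move=> ck; apply: mk; rewrite in_cons ck orbT.
case: asboolP => [mc'|_]; last by rewrite add0e; exact: IHk.
have mc : meets (U i) c r by apply: mk mc'; rewrite mem_head.
rewrite big_seq big1 => [|c'' c''k]; first by rewrite adde0 asboolT.
(* Two children met by [U i] would have centres at distance below r' + r' + r', against their
   separation. *)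
case: asboolP => // -[y Uy c''y]; exfalso.
have [x Ux c'x] := mc'.
have := small i x y mc Ux Uy; have := c'k _ c''k.
have := supdist_triangle x c' c''; have := supdist_triangle y x c''.
rewrite (supdistC y c''); lra.
Qed.

End CoverWeight.

(** * Many separated children away from a hyperplane *)

Section GoodChildren.
Variables (R : realType) (N : nat) (m : {measure set (@borelV R N) -> \bar R}).
Local Notation V := 'rV[R]_N.

Lemma half_le_sube (X Y : \bar R) (p : R) : X \is a fin_num ->
  (0 <= Y)%E -> (Y <= (1 / 2)%:E * X)%E -> (p%:E <= X)%E -> ((p / 2)%:E <= X - Y)%E.
Proof.
case: X => [x| |] //; case: Y => [y| |] // _; rewrite -EFinM // -EFinB !lee_fin; lra.
Qed.

(** By decay, removing the neighbourhood of [L] leaves at least half the measure of the ball of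
    radius [r / 2]. Dividing by the largest measure of a ball of radius [3 * (r / M)] counts the
    separated centres. *)
Lemma exists_good_children (Om : set V) (delta r0 a b alpha C M t : R) (L : set V) (c : V) (r : R) :
  m.-negligible (~` Om) -> measurable (Om : set (@borelV R N)) ->
  0 < delta -> 0 < a -> 0 < b ->
  (forall (c : V) (r : R), Om c -> 0 < r -> r <= r0 ->
      ((a * r `^ delta)%:E <= m (sball c r) <= (b * r `^ delta)%:E)%E) ->
  (forall (L : set V) (eps : R) (x : V) (r : R),
      affine_hyperplane L -> 0 < eps -> Om x -> 0 < r -> r < r0 ->
      (m (sball x r `&` nbhd_set L eps) <=
        (C * (eps / r) `^ alpha)%:E * m (sball x r))%E) ->
  affine_hyperplane L -> Om c -> 0 < r -> 3 * r <= r0 -> 1 <= M ->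
  C * (4 / M) `^ alpha <= 1 / 2 ->
  M `^ t <= a / (4 * b * 6 `^ delta) * M `^ delta ->
  exists l, [/\ M `^ t <= (size l)%:R,
    forall c', c' \in l -> [/\ Om c', supdist c c' <= r / 2 & ~ nbhd_set L (2 * (r / M)) c'] &
    pairwise (fun x y => 3 * (r / M) < supdist x y) l].
Proof.
move=> nOm mOm delta0 a0 b0 ahl dec hL Omc r_gt0 r_le M1 CM tM.
have M0 : 0 < M by lra.
have rM_gt0 : 0 < r / M by rewrite divr_gt0.
have rM_le : r / M <= r by rewrite ler_pdivrMr // ler_peMr // ltW.
have eps_gt0 : 0 < 2 * (r / M) by rewrite mulr_gt0.
(* Centres are taken in the half ball so that the children fit into the ball of radius [r] once [M]
   is at least 2. *)
pose B : set (@borelV R N) := sball c (r / 2).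
pose G : set (@borelV R N) := B `\` (nbhd_set L (2 * (r / M)) : set (@borelV R N)).
have r2_gt0 : 0 < r / 2 by lra.
have r2_le : r / 2 <= r0 by lra.
have /andP[Blo Bhi] := ahl c (r / 2) Omc r2_gt0 r2_le.
have mB : measurable B by exact: measurable_sball.
have mL : measurable (nbhd_set L (2 * (r / M)) : set (@borelV R N)).
  exact: measurable_nbhd_set.
have Bfin : m B \is a fin_num.
  by rewrite ge0_fin_numE // (le_lt_trans Bhi) // ltry.
have BL : (m (B `&` (nbhd_set L (2 * (r / M)) : set (@borelV R N))) <= (1 / 2)%:E * m B)%E.
  apply: le_trans (dec L _ c (r / 2) hL eps_gt0 Omc r2_gt0 _) _; first lra.
  rewrite (_ : 2 * (r / M) / (r / 2) = 4 / M); last by field; rewrite !gt_eqF.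
  by apply: lee_wpmul2r => //; rewrite lee_fin.
have mG : ((a / 2 * (r / 2) `^ delta)%:E <= m G)%E.
  rewrite measureD ?(ltey_eq, Bfin) // (_ : a / 2 * _ = a * (r / 2) `^ delta / 2); last by ring.
  exact: half_le_sube.
pose v := b * (3 * (r / M)) `^ delta.
have v0 : 0 <= v by rewrite mulr_ge0 ?powR_ge0 // ltW.
pose k := Num.trunc (M `^ t).
have /andP[kt tk] := truncn_itv (powR_ge0 M t).
have kG : ((k%:R * v)%:E < m G)%E.
  apply: lt_le_trans mG; rewrite lte_fin.
  (* The constant is such that this product equals a/4 times the delta-th power of [r / 2], half the
     lower bound for [m G]; the 6 is the ratio of 3r to r/2. *)
  apply: (@le_lt_trans _ _ (a / (4 * b * 6 `^ delta) * M `^ delta * v)).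
    by rewrite ler_wpM2r // (le_trans kt).
  have r2E : (3 * (r / M)) `^ delta * M `^ delta = 6 `^ delta * (r / 2) `^ delta.
    rewrite -!powRM ?ltW //; last by rewrite mulr_gt0.
    by congr (_ `^ _); field; rewrite gt_eqF.
  have six : 6 `^ delta != 0 :> R by rewrite gt_eqF // powR_gt0.
  rewrite (_ : _ * v = a / 4 * (r / 2) `^ delta).
    by rewrite ltr_pM2r ?powR_gt0 //; lra.
  rewrite /v (_ : _ * _ = a / (4 * 6 `^ delta) * ((3 * (r / M)) `^ delta * M `^ delta)).
    by rewrite r2E; field.
  by field; rewrite six gt_eqF.
have r3_gt0 : 0 < 3 * (r / M) by lra.
have r3_le : 3 * (r / M) <= r0 by lra.
have [|l [lk lG pl]] := separated_centers nOm mOm (measurableD mB mL) v0 _ kG (r := 3 * (r / M)).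
  by move=> c' Omc'; have /andP[] := ahl c' _ Omc' r3_gt0 r3_le.
exists l; split=> //; first by rewrite lk ltW.
by move=> c' /lG[Omc' [Bc' Lc']].
Qed.

End GoodChildren.

(** * Positive Hausdorff measure below the critical exponent *)

Section LowerBound.
Variables (R : realType) (N : nat) (m : {measure set (@borelV R N) -> \bar R}).
Local Notation V := 'rV[R]_N.

Lemma hmeasure_Bad_neq0 (Om : set V) (delta r0 a b alpha C s : R) (c0 : V) :
  (0 < N)%N ->
  m.-negligible (~` Om) -> closed Om -> Om c0 ->
  0 < delta -> 0 < r0 -> 0 < a -> 0 < b ->
  (forall (c : V) (r : R), Om c -> 0 < r -> r <= r0 ->
      ((a * r `^ delta)%:E <= m (sball c r) <= (b * r `^ delta)%:E)%E) ->
  0 < alpha ->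
  (forall (L : set V) (eps : R) (x : V) (r : R),
      affine_hyperplane L -> 0 < eps -> Om x -> 0 < r -> r < r0 ->
      (m (sball x r `&` nbhd_set L eps) <=
        (C * (eps / r) `^ alpha)%:E * m (sball x r))%E) ->
  0 <= s -> s < delta -> hmeasure s (Om `&` @Bad R N) <> 0%E.
Proof.
move=> N0 nOm cOm Omc0 delta0 r0_gt0 a0 b0 ahl alpha0 dec s0 sdelta hs0.
have mOm : measurable (Om : set (@borelV R N)) by exact: measurable_closed_borelV.
(* Thresholds are [t]-th powers of radii: [t < delta] gives enough children for large [M], and
   [t > 0], even for [s = 0], makes the thresholds tend to 0. *)
pose t := (s + delta) / 2.
have st : s < t by rewrite /t; lra.
have td : 0 < delta - t by rewrite /t; lra.
have t0 : 0 < t by lra.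
pose kappa := a / (4 * b * 6 `^ delta).
have kappa0 : 0 < kappa by rewrite divr_gt0 // !mulr_gt0 // powR_gt0.
have [X1 X1P] := powR_ge_eventually (2 * C * 4 `^ alpha) alpha0.
have [X2 X2P] := powR_ge_eventually kappa^-1 td.
(* [X1] secures the decay estimate [CM] and [X2] the child count [tM]. *)
pose H := maxn 2 (Num.bound `|Num.max X1 X2|).
pose M : R := (H ^ N.+1)%:R.
have H1 : (1 < H)%N by rewrite leq_max.
have HM : H%:R <= M by rewrite ler_nat -{1}(expn1 H) leq_exp2l.
have M2 : 2 <= M by apply: le_trans HM; rewrite ler_nat leq_max.
have XM : Num.max X1 X2 <= M.
  apply: le_trans HM; apply: (@le_trans _ _ (Num.bound `|Num.max X1 X2|)%:R).
    by apply: le_trans (ler_norm _) _; exact/ltW/archi_boundP.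
  by rewrite ler_nat leq_maxr.
have /andP[X1M X2M] : (X1 <= M) && (X2 <= M) by rewrite -ge_max.
have M0 : 0 < M by lra.
have M1 : 1 <= M by lra.
have CM : C * (4 / M) `^ alpha <= 1 / 2.
  have Ma0 : 0 < M `^ alpha by rewrite powR_gt0.
  have : (4 / M) `^ alpha * M `^ alpha = 4 `^ alpha.
    by rewrite -powRM ?divfK ?gt_eqF // ?divr_ge0 // ltW.
  move=> E4; rewrite -(ler_pM2r Ma0) -mulrA E4; have := X1P M X1M; lra.
have tM : M `^ t <= kappa * M `^ delta.
  have -> : M `^ delta = M `^ (delta - t) * M `^ t.
    by rewrite -powRD ?subrK // (gt_eqF M0) implybT.
  rewrite mulrA -[leLHS]mul1r ler_wpM2r ?powR_ge0 // -(mulfV (lt0r_neq0 kappa0)).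
  by rewrite ler_pM2l // X2P.
pose F : R := (N.+1)`!%:R.
have F1 : 1 <= F by rewrite ler1n fact_gt0.
(* The first entry keeps the radii [3 * r n] below [r0]; the second makes the simplex bound at most
   1/2 at every level, since M^(n+1) times [2 * r n] is always [2 * rho * M]. *)
pose rho := Num.min (r0 / 4) (1 / (4 * M * F)).
have rho0 : 0 < rho by rewrite lt_min !divr_gt0 // !mulr_gt0 //; lra.
have rho_r0 : rho <= r0 / 4 by rewrite ge_min lexx.
have rhoM : 2 * rho * M <= 1 / (2 * F).
  have F0 : 0 < F by lra.
  apply: (@le_trans _ _ (2 * (1 / (4 * M * F)) * M)).
    by rewrite ler_pM2r // ler_pM2l // ge_min lexx orbT.
  by rewrite le_eqVlt; apply/orP; left; apply/eqP; field; rewrite !gt_eqF.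
pose r n := rho / M ^+ n.
have rS n : r n.+1 = r n / M by rewrite /r exprS; field; rewrite ?expf_neq0 gt_eqF.
have r_gt0 n : 0 < r n by rewrite divr_gt0 // exprn_gt0.
have r_half n : r n.+1 <= r n / 2.
  by rewrite rS ler_pM2l // lef_pV2 ?posrE.
have r_rho n : r n <= rho.
  by rewrite /r ler_pdivrMr ?exprn_gt0 // ler_peMr ?(ltW rho0) // exprn_ege1.
have simplex_small n :
    (N.+1)`!%:R * (((H ^ (N * n.+1))%:R : R) ^+ N.+1 * (2 * r n) ^+ N) < 1.
  rewrite -/F.
  have -> : ((H ^ (N * n.+1))%:R : R) ^+ N.+1 = (M ^+ n.+1) ^+ N.
    by rewrite /M -!natrX expnMSAC.
  rewrite -exprMn (_ : _ * (2 * r n) = 2 * rho * M); last first.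
    by rewrite /r exprS; field; rewrite expf_neq0 ?gt_eqF.
  have rM0 : 0 < 2 * rho * M by rewrite !mulr_gt0.
  apply: (@le_lt_trans _ _ (F * (1 / (2 * F)))); last first.
    by rewrite (_ : F * _ = 1 / 2); [lra|field; lra].
  rewrite ler_pM2l; last lra.
  apply: le_trans (rhoM); rewrite -[N]prednK // exprS ger_pMr // exprn_ile1 ?(ltW rM0) //.
  by apply: le_trans rhoM _; rewrite ler_pdivrMr; lra.
(* One half bounds the cost of the cover and the other half is spent on the extra summands of
   [w]. *)
pose e := r 1%N `^ t / 2.
have e0 : 0 < e by rewrite divr_gt0 // powR_gt0.
have : (hcontent s 1 (Om `&` @Bad R N) < e%:E)%E.
  apply: (@le_lt_trans _ _ 0%E); last by rewrite lte_fin.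
  by rewrite -hs0; apply: ereal_sup_ubound; exists 1 => //=; exact: ltr01.
move=> /ereal_inf_lt[_ [U [EU Ud] <-] Ue].
pose w i := (dpow s (U i) + (e / (2 ^ i.+1)%:R)%:E)%E.
have ei0 i : 0 < e / (2 ^ i.+1)%:R by rewrite divr_gt0 // ltr0n expn_gt0.
have w_ge i : ((e / (2 ^ i.+1)%:R)%:E <= w i)%E by rewrite leeDr // dpow_ge0.
have w_ge0 i : (0 <= w i)%E by apply: le_trans (w_ge i); rewrite lee_fin ltW.
have sum_w : (\sum_(0 <= i <oo) w i < (r 1%N `^ t)%:E)%E.
  apply: le_lt_trans (epsilon_trick _ _ (ltW e0)) _; first by move=> i; exact: dpow_ge0.
  have -> : r 1%N `^ t = e + e by rewrite /e; lra.
  by rewrite EFinD lteD2rE.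
(* The threshold uses the next radius, so that a set meeting the ball is smaller than the children;
   for [n = 0] it follows from the bound on the total weight. *)
pose inv n c := Om c /\ (ball_weight w U c (r n) < (r n.+1 `^ t)%:E)%E.
pose next n c c' := exists2 L, forall (q : nat) (p : 'I_N -> int), (0 < q)%N ->
    q%:R <= (H ^ (N * n.+1))%:R :> R ->
    supdist c (\row_i ((p i)%:~R / q%:R)) <= 2 * r n -> L (\row_i ((p i)%:~R / q%:R)) &
  ~ nbhd_set L (2 * r n.+1) c' /\ supdist c c' <= r n / 2.
have step n c : inv n c -> exists2 c', inv n.+1 c' & next n c c'.
  move=> [Omc Wc].
  have [|L hL LP] := simplex_hyperplane c N0 _ (ler0n _ _) (simplex_small n).
    by rewrite mulr_ge0 // ltW.
  have r3 : 3 * r n <= r0 by have := r_rho n; lra.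
  have [l [lM lP pl]] := exists_good_children nOm mOm delta0 a0 b0 ahl dec hL Omc (r_gt0 n) r3 M1 CM tM.
  rewrite -rS in lP pl.
  have [|i x y Ui Ux Uy||c' c'l Wc'] := exists_light_child (w := w) (U := U) (r := r n)
      (tau' := r n.+2 `^ t) w_ge0 _ pl _ Wc.
  - by move=> c' /lP[_ cc' _]; have := r_half n; lra.
  - rewrite ltNge; apply/negP => rxy.
    have : ((r n.+1 `^ t)%:E <= ball_weight w U c (r n))%E.
      apply: le_trans (le_ball_weight w_ge0 Ui).
      apply: (@le_trans _ _ (dpow s (U i))); last by rewrite leeDl // lee_fin ltW.
      apply: le_trans (powR_supdist_le_dpow s0 (ltW st) (Ud i) Ux Uy).
      by rewrite lee_fin; apply: ge0_ler_powR; rewrite ?nnegrE ?supdist_ge0 // ltW.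
    by rewrite leNgt Wc.
  (* Passing to the next level divides the threshold by the [t]-th power of [M], which the number of
     children compensates. *)
  - apply: (@le_trans _ _ (M `^ t * r n.+2 `^ t)); last by rewrite ler_wpM2r // powR_ge0.
    by rewrite -powRM ?(ltW M0) ?(ltW (r_gt0 _)) // (rS n.+1) mulrC divfK ?gt_eqF.
  - have [Omc' cc' Lc'] := lP _ c'l.
    by exists c' => //; exists L.
(* Choice needs a total successor map; where [inv] fails the value 0 is arbitrary and is never
   reached from [c0]. *)
have /choice[f fP] : forall nc : nat * V, exists c', inv nc.1 nc.2 -> inv nc.1.+1 c' /\ next nc.1 nc.2 c'.
  move=> [n c]; case: (pselect (inv n c)) => [/step[c' ? ?]|ninv]; first by exists c'.
  by exists 0.
pose c := fix c n := if n is n'.+1 then f (n', c n') else c0.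
have inv0 : inv 0%N c0.
  by split=> //; apply: le_lt_trans sum_w; exact: ball_weight_le.
have invc n : inv n (c n) by elim: n => [//|n IHn]; have [] := fP (n, c n) IHn.
have nextc n : next n (c n) (c n.+1) by have [] := fP (n, c n) (invc n).
have /choice[L LP] : forall n, exists L, (forall (q : nat) (p : 'I_N -> int), (0 < q)%N ->
    q%:R <= (H ^ (N * n.+1))%:R :> R ->
    supdist (c n) (\row_i ((p i)%:~R / q%:R)) <= 2 * r n -> L (\row_i ((p i)%:~R / q%:R))) /\
    ~ nbhd_set L (2 * r n.+1) (c n.+1).
  by move=> n; have [L ? [? _]] := nextc n; exists L.
have [x cx] : exists x, forall n, supdist (c n) x <= r n.
  apply: nested_balls => n; last exact: ltW.
  by have [_ _ [_]] := nextc n; have := r_half n; lra.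
have Omx : Om x.
  apply: (closed_limit_balls cOm _ cx) => [n|d d0]; first by have [] := invc n.
  exact: geometric_radius_small.
have Bx : Bad x.
  apply: (Bad_avoiding_hyperplanes (L := L) N0 H1 rho0 cx) => n.
    by have [] := LP n.
  by have [] := LP n.
(* This [U i] meets every ball of the sequence, so [w i] lies below all thresholds, although it is
   at least its extra summand. *)
have [i _ Uix] := EU x (conj Omx Bx).
have di0 : 0 < (e / (2 ^ i.+1)%:R) `^ t^-1 by rewrite powR_gt0.
have [n rn] := geometric_radius_small M2 rho0 di0.
have [_ Wn] := invc n.
have : ((e / (2 ^ i.+1)%:R)%:E < (r n.+1 `^ t)%:E)%E.
  apply: le_lt_trans (w_ge i) _; apply: le_lt_trans Wn.
  by apply: le_ball_weight => //; exists x.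
rewrite lte_fin ltNge => /negP; apply.
have -> : e / (2 ^ i.+1)%:R = ((e / (2 ^ i.+1)%:R) `^ t^-1) `^ t.
  by rewrite -powRrM mulVf ?powRr1 ?(ltW (ei0 i)) // gt_eqF.
apply: ge0_ler_powR; rewrite ?nnegrE ?(ltW t0) ?(ltW (r_gt0 _)) ?(ltW di0) //.
by have := r_half n; have := r_gt0 n; rewrite -/(r n) in rn; lra.
Qed.

End LowerBound.

(** * Both dimensions compared with the exponent of condition (A) *)

Unset Implicit Arguments.
Set Strict Implicit.
Set Printing Implicit Defensive.

Theorem theorem4 (R : realType) (N : nat) (Om : set 'rV[R]_N)
  (m : {measure set (@borelV R N) -> \bar R}) :
  (0 < N)%N ->
  compact Om ->
  msupport m = Om ->
  non_atomic m ->
  (m setT < +oo)%E ->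
  condA Om m ->
  (exists alpha : R, 0 < alpha /\ abs_decaying Om m alpha) ->
  hdim (Om `&` @Bad R N) = hdim Om.
Proof.
move=> N0 compOm suppOm _ mfin [delta [r0 [a [b [[delta0 r0_gt0 a0 a1 b1] ahl]]]]].
move=> [alpha [alpha0 [C [r1 [C0 [r1_gt0 dec]]]]]].
apply/eqP; rewrite eq_le hdim_subset /=; last exact: subIsetl.
have [->|/set0P[c0 Omc0]] := eqVneq Om set0; first by rewrite set0I.
have cOm : closed Om by apply: compact_closed => //; exact: norm_hausdorff.
have nOm : m.-negligible (~` Om) by rewrite -suppOm; exact: negligible_setC_msupport.
have b0 : 0 < b by lra.
apply: (@le_trans _ _ delta%:E).
  pose M := fine (m setT).
  have mM : (m setT <= M%:E)%E by rewrite fineK // ge0_fin_numE.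
  (* Condition (A) is applied at radius [r / 2], because a maximal separated set covers only at
     twice the radius; this explains both factors 2. *)
  apply: (@hdim_le_covering _ _ _ _ (2 * r0) (M / a * 2 `^ delta)) => // [|r r_gt0 r_le].
    by rewrite mulr_gt0.
  have r2_gt0 : 0 < r / 2 by lra.
  have ballv c : Om c -> ((a * (r / 2) `^ delta)%:E <= m (sball c (r / 2)))%E.
    by move=> Omc; have /andP[] := ahl c (r / 2) Omc r2_gt0 ltac:(lra).
  have v0 : 0 < a * (r / 2) `^ delta by rewrite mulr_gt0 // powR_gt0.
  have [l lcov lM] := separated_covering (ltW r2_gt0) v0 mM ballv.
  exists l => [x /lcov[c cl cx]|]; first by exists c => //; rewrite mulrC divfK in cx.
  have rE : r `^ delta = 2 `^ delta * (r / 2) `^ delta.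
    by rewrite -powRM ?(ltW r2_gt0) // mulrC divfK.
  rewrite rE mulrCA [leRHS]mulrC ler_pM2l ?powR_gt0 // ler_pdivlMr //.
  by rewrite -mulrA [_ * a]mulrC.
apply: le_ereal_inf_tmp => _ [s [s0 hs0] <-]; rewrite lee_fin leNgt; apply/negP => sdelta.
(* The minimum is a scale at which condition (A) and the decay condition both hold. *)
apply: (hmeasure_Bad_neq0 (r0 := Num.min r0 r1) N0 nOm cOm Omc0 delta0 _ a0 b0 _ alpha0 _ s0 sdelta hs0).
- by rewrite lt_min r0_gt0.
- by move=> c r Omc r_gt0; rewrite le_min => /andP[rr0 _]; exact: ahl.
- by move=> L eps x r hL eps0 Omx r_gt0; rewrite lt_min => /andP[_ rr1]; exact: dec.
Qed.
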